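(* Let $n\ge 1$ and let $U\in U(2^n)$ be a semi-Clifford gate. Then $U\in\mathcal{CH}$ if and only if $U$ can be written (up to a global phase) in the form $$U = C_1 \prod_j \exp\left(i\frac{\alpha_j\pi}{2^{k_j}} Z_j\right) C_2,$$ where $C_1,C_2$ are $n$-qubit Clifford gates, the $Z_j$ are non-identity Pauli $Z$ strings, the $\alpha_j$ are integers and the $k_j$ are positive integers.
   Context: Gates are unitary matrices in $U(2^n)$ considered up to a global phase. A Pauli string is an element of the $n$-qubit Pauli group $\mathcal{P}_n=\langle i,X,Z\rangle^{\otimes n}$; a Pauli $Z$ string is a tensor product of $Z$'s and identities. The Clifford Hierarchy is defined by $\mathcal{CH}_1=\mathcal{P}_n$ (up to phase) and, for $k\ge 2$, $\mathcal{CH}_k=\{U\in U(2^n) : UpU^\dagger\in\mathcal{CH}_{k-1}\ \forall p\in\mathcal{P}_n\}$; $\mathcal{CH}_2$ is the $n$-qubit Clifford group. A gate is in $\mathcal{CH}$ if it is in $\mathcal{CH}_k$ for some $k\ge 1$. A gate $U\in U(2^n)$ is semi-Clifford if it can be written (up to phase) as $C_1\prod_j\exp(i\theta_jZ_j)C_2$ with $C_1,C_2$ $n$-qubit Clifford gates, $\theta_j\in[0,2\pi)$ and $Z_j$ non-identity Pauli $Z$ strings. *)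

(* Defs.v *)
From HB Require Import structures.
From mathcomp Require Import all_boot all_order all_algebra.
From mathcomp Require Import sesquilinear spectral.
From mathcomp Require Import all_classical all_reals all_analysis.
From mathcomp Require Import complex mxtens.

Set Implicit Arguments.
Unset Strict Implicit.
Unset Printing Implicit Defensive.

Import Order.TTheory GRing.Theory Num.Theory numFieldNormedType.Exports.

Local Open Scope ring_scope.
Local Open Scope sesquilinear_scope.
Local Open Scope complex_scope.
Local Open Scope classical_set_scope.

(* The topology on matrices is the entrywise one; for K = R[i] the series
   always converges, so [limn] never takes its default value there. *)
Definition mxexp (K : numFieldType) (m : nat) (A : 'M[K]_m) : 'M[K]_m :=
  limn (series (fun k => k`!%:R^-1 *: A ^+ k)).

(* A 0 (x) A 1 (x) ... (x) A (n-1); the cast is along 2 ^ n.+1 = 2 * 2 ^ n. *)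
Fixpoint tens (K : pzRingType) (n : nat) :
    ('I_n -> 'M[K]_2) -> 'M[K]_(2 ^ n) :=
  match n with
  | 0 => fun=> 1%:M
  | n'.+1 => fun A =>
      castmx (esym (expnS 2 n'), esym (expnS 2 n'))
        (tensmx (A ord0) (tens (fun i => A (lift ord0 i))))
  end.

Section Gates.
Context {R : realType}.

Definition pauliX : 'M[R[i]]_2 := \matrix_(i, j) (i != j)%:R.

Definition pauliZ : 'M[R[i]]_2 := \matrix_(i, j) ((-1) ^+ i *+ (i == j)).

(* The group <i, X, Z>. *)
Inductive pauli1 : 'M[R[i]]_2 -> Prop :=
| pauli1_one : pauli1 1%:M
| pauli1_i : pauli1 ('i%:M)
| pauli1_X : pauli1 pauliX
| pauli1_Z : pauli1 pauliZ
| pauli1_mul A B : pauli1 A -> pauli1 B -> pauli1 (A *m B)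
| pauli1_inv A : pauli1 A -> pauli1 (invmx A).

Context {n : nat}.
Implicit Types U V p : 'M[R[i]]_(2 ^ n).

Definition pauli p : Prop :=
  exists A : 'I_n -> 'M[R[i]]_2, (forall q, pauli1 (A q)) /\ p = tens A.

Definition pauliZ_string p : Prop :=
  exists A : 'I_n -> 'M[R[i]]_2,
    (forall q, A q = 1%:M \/ A q = pauliZ) /\ p = tens A.

Definition nonid_pauliZ_string p : Prop := pauliZ_string p /\ p <> 1%:M.

Definition eq_phase U V : Prop := exists2 c : R[i], `|c| = 1 & U = c *: V.

(* The hierarchy starts at level 1; level 0 is empty by convention. *)
Fixpoint CH (k : nat) U : Prop :=
  match k with
  | 0 => False
  | 1 => exists2 p, pauli p & eq_phase U p
  | k'.+1 => U \is unitarymx /\ forall p, pauli p -> CH k' (U *m p *m U^t*)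
  end.

Definition clifford U : Prop := CH 2 U.

Definition inCH U : Prop := exists2 k : nat, (1 <= k)%N & CH k U.

Definition expi (theta : R) p : 'M[R[i]]_(2 ^ n) :=
  mxexp (('i * theta%:C) *: p).

Definition semi_clifford U : Prop :=
  U \is unitarymx /\
  exists (C1 C2 : 'M[R[i]]_(2 ^ n)) (m : nat) (theta : 'I_m -> R)
         (Z : 'I_m -> 'M[R[i]]_(2 ^ n)),
    [/\ clifford C1, clifford C2,
        forall j, 0 <= theta j < 2 * pi,
        forall j, nonid_pauliZ_string (Z j) &
        eq_phase U (C1 *m (\prod_(j < m) expi (theta j) (Z j)) *m C2)].

End Gates.

(* Main.v *)
Require Import Defs.
From mathcomp Require Import all_boot all_order all_algebra.
From mathcomp Require Import sesquilinear spectral.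
From mathcomp Require Import all_classical all_reals all_analysis.
From mathcomp Require Import complex mxtens ring.

Set Implicit Arguments.
Unset Strict Implicit.
Unset Printing Implicit Defensive.

Import Order.TTheory GRing.Theory Num.Theory numFieldNormedType.Exports.

Local Open Scope ring_scope.
Local Open Scope complex_scope.
Local Open Scope sesquilinear_scope.

(** A unitary commuting up to sign with every Pauli is a phase times a Pauli.
    Hence the inverse of a Clifford is Clifford, every level [CH k] with
    [k >= 2] is stable under multiplication by Cliffords on both sides, and
    only the diagonal factor [D] of a semi-Clifford gate matters.

    If all angles of [D] are multiples of [pi / 2 ^ d], then conjugating a
    string by a Pauli [p] only changes its sign, so [D p D^*] is [p] times a
    diagonal gate whose angles are [0] or doubled: [D] is in [CH d.+1] by
    induction on [d].

    Conversely, if [D] is in [CH k], so is [D p D^* p^*], and induction on [k]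
    shows that [D ^ (2 ^ k)] is scalar.  So up to phase the entries of [D] are
    roots of unity of order [2 ^ k], and Fourier inversion over [(Z/2)^n]
    writes [D] as a product of dyadic rotations along Z strings. *)

(** * Rotations *)

Section Phase.
Context {R : realType}.
Implicit Types a b : R.

(** The exponential e^{ia}, kept in terms of the real cosine and sine so that the real trigonometric
    series apply. *)
Definition cis a : R[i] := (cos a)%:C + 'i * (sin a)%:C.

Lemma cis0 : cis 0 = 1.
Proof. by rewrite /cis cos0 sin0 mulr0 addr0. Qed.

Lemma cisD a b : cis (a + b) = cis a * cis b.
Proof.
rewrite /cis cosD sinD !(rmorphB, rmorphD, rmorphM) /=.
have := sqrCi R[i]; rewrite expr2 => i2.
rewrite !mulrDl !mulrDr [X in _ + (_ + X)](_ : _ = - ((sin a)%:C * (sin b)%:C)).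
  ring.
by rewrite mulrACA i2 mulN1r.
Qed.

Lemma cis_sum (I : Type) (r : seq I) (F : I -> R) :
  cis (\sum_(j <- r) F j) = \prod_(j <- r) cis (F j).
Proof. by elim/big_rec2: _ => [|j x y _ <-]; rewrite ?cis0 ?cisD. Qed.

Lemma conj_cis a : Num.conj (cis a) = cis (- a).
Proof.
rewrite /cis cosN sinN rmorphN rmorphD rmorphM /= conjCi.
by rewrite !conj_Creal ?mulrN ?mulNr //; apply/complex_realP; eexists.
Qed.

Lemma norm_cis a : `|cis a| = 1.
Proof.
by apply/eqP; rewrite -sqrp_eq1 // normCK conj_cis -cisD subrr cis0.
Qed.

Lemma cis_pi : cis pi = -1.
Proof. by rewrite /cis cospi sinpi mulr0 addr0 rmorphN1. Qed.

Lemma cis_intpi (z : int) : cis (z%:~R * pi) = 1 \/ cis (z%:~R * pi) = -1.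
Proof.
have ein (m : nat) : cis (m%:R * pi) = 1 \/ cis (m%:R * pi) = -1.
  elim: m => [|m IH]; first by left; rewrite mul0r cis0.
  rewrite -addn1 natrD mulrDl mul1r cisD cis_pi mulrN1.
  by case: IH => ->; [right|left; rewrite opprK].
case: z => m; first exact: ein.
rewrite NegzE rmorphN /= mulNr -conj_cis.
by case: (ein m.+1) => ->; [left|right]; rewrite ?rmorphN rmorph1.
Qed.

(** Induction by square roots: the root [- cis t] equals [cis (t + pi)], which shifts the numerator
    [z] by [2 ^+ d]. *)
Lemma cis_root (d : nat) (c : R[i]) :
  c ^+ (2 ^ d) = 1 -> exists z : int, c = cis (z%:~R * (pi *+ 2) / 2 ^+ d).
Proof.
elim: d c => [|d IH] c; first by exists 0; rewrite -[c]expr1 !mul0r cis0.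
rewrite expnS exprM => /IH[z cz].
set t := z%:~R * (pi *+ 2) / 2 ^+ d.+1 : R.
have : c ^+ 2 == cis t ^+ 2.
  rewrite cz expr2 -cisD /t exprS; apply/eqP; congr cis.
  by field; rewrite expf_neq0 // pnatr_eq0.
rewrite eqf_sqr => /orP[] /eqP ->; first by exists z.
exists (z + 2 ^+ d); rewrite -mulN1r -cis_pi -cisD; congr cis.
rewrite /t rmorphD rmorphXn /= exprS.
by field; rewrite expf_neq0 // pnatr_eq0.
Qed.

Lemma cvg_real_complex (u : R^nat) (l : R) :
  (u @ \oo --> l)%classic ->
  ((u n)%:C @[n --> \oo] --> (l%:C : (R[i] : numFieldType)))%classic.
Proof.
move=> ul; apply/(@cvgrPdist_lt _ (R[i] : numFieldType)) => e e0.
(* A positive complex number is real, so epsilon comes from [R]. *)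
have /complex_realP[r er] : e \is Num.real by rewrite gtr0_real.
have r0 : 0 < r by move: e0; rewrite er ltcR.
move/cvgrPdist_lt: ul => /(_ _ r0); apply: filterS => n.
rewrite er -rmorphB /= normc_def /= expr0n addr0 ltcR sqrtr_sqr.
by [].
Qed.

Lemma expmxZ (m k : nat) (c : R[i]) (A : 'M[R[i]]_m) :
  (c *: A) ^+ k = c ^+ k *: A ^+ k.
Proof.
elim: k => [|k IH]; first by rewrite !expr0 scale1r.
by rewrite !exprS IH -!mulmxE -scalemxAl -scalemxAr scalerA.
Qed.

(** Even powers of [Z] are 1 and odd powers are [Z], so each partial sum splits into partial sums of
    the cosine and sine series. *)
Lemma mxexp_involution (m : nat) a (Z : 'M[R[i]]_m) :
  Z *m Z = 1%:M ->
  mxexp (('i * a%:C) *: Z) = (cos a)%:C *: 1%:M + ('i * (sin a)%:C) *: Z.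
Proof.
move=> Z2; rewrite /mxexp; apply: cvg_lim; first exact: norm_hausdorff.
rewrite (_ : series _ = fun N =>
    (series (cos_coeff a) N)%:C *: 1%:M + ('i * (series (sin_coeff a) N)%:C) *: Z).
  apply: cvgD; apply: cvgZr_tmp.
    apply: cvg_real_complex; rewrite unlock; exact: is_cvg_series_cos_coeff.
  apply: cvgMl_tmp.
  apply: cvg_real_complex; rewrite unlock; exact: is_cvg_series_sin_coeff.
apply/funext => N; rewrite /series /= !rmorph_sum /= mulr_sumr !scaler_suml.
rewrite -big_split /=; apply: eq_bigr => k _.
have Zpow : Z ^+ k = if odd k then Z else 1%:M.
  elim: k => [//|k IH]; rewrite exprS IH /=; case: (odd k) => /=.
    exact: Z2.
  exact: mulmx1.
have ipow : ('i%R : R[i]) ^+ k = (if odd k then 'i else 1) * (-1) ^+ k./2.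
  rewrite -{1}(odd_double_half k) exprD -muln2 mulnC exprM sqrCi.
  by case: (odd k); rewrite ?expr0 ?expr1.
rewrite expmxZ Zpow exprMn ipow scalerA /cos_coeff /sin_coeff /=.
rewrite !(rmorphM, fmorphV, rmorph_nat, rmorphXn, rmorphN1) /=.
case: ifP => k_odd /=; rewrite ?(mul0r, mulr0, scale0r, add0r, addr0, mul1r).
  have -> : k.-1./2 = k./2 by rewrite -[in LHS](odd_double_half k) k_odd /= doubleK.
  by congr (_ *: _); rewrite mulrC !mulrA.
by congr (_ *: _); rewrite mulrC.
Qed.
End Phase.

(** * Entries of tensor products *)

(* Most significant digit first, matching the order of factors in [tens]. *)
Fixpoint bits (n : nat) : 'I_(2 ^ n) -> 'I_n -> 'I_2 :=
  match n with
  | 0 => fun _ _ => ord0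
  | n'.+1 => fun x i =>
      let u := mxtens_unindex (cast_ord (expnS 2 n') x) in
      if unlift ord0 i is Some j then bits u.2 j else u.1
  end.

Lemma bitsS (n : nat) (x : 'I_(2 ^ n.+1)) (i : 'I_n.+1) :
  let u := mxtens_unindex (cast_ord (expnS 2 n) x) in
  bits x i = if unlift ord0 i is Some j then bits u.2 j else u.1.
Proof. by []. Qed.

Lemma bits_surj (n : nat) (b : 'I_n -> 'I_2) : exists x, bits x =1 b.
Proof.
elim: n b => [|n IH] b; first by exists ord0 => -[].
have [x xb] := IH (fun i => b (lift ord0 i)).
exists (cast_ord (esym (expnS 2 n)) (mxtens_index (b ord0, x))) => i.
rewrite bitsS cast_ordKV mxtens_indexK.
by case: unliftP => [j|] ->; rewrite ?xb.
Qed.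

Lemma tensE (K : comPzRingType) (n : nat) (A : 'I_n -> 'M[K]_2) x y :
  tens A x y = \prod_i A i (bits x i) (bits y i).
Proof.
elim: n A x y => [|n IH] A x y.
  by rewrite big_ord0 /= mxE !ord1 eqxx.
rewrite big_ord_recl castmxE mxE !bitsS unlift_none esymK IH.
by congr (_ * _); apply: eq_bigr => i _; rewrite !bitsS liftK.
Qed.

Lemma bits_inj (n : nat) (x y : 'I_(2 ^ n)) : bits x =1 bits y -> x = y.
Proof.
elim: n x y => [|n IH] x y xy; first by rewrite (ord1 x) (ord1 y).
apply: (@cast_ord_inj _ _ (expnS 2 n)).
rewrite -[LHS]mxtens_unindexK -[RHS]mxtens_unindexK; congr mxtens_index.
have xy0 := xy ord0; rewrite !bitsS unlift_none in xy0.
apply: injective_projections; first exact: xy0.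
by apply: IH => i; have := xy (lift ord0 i); rewrite !bitsS liftK.
Qed.

(** The boolean clause is the form in which Z on qubit [i] is seen to take opposite signs at [x] and
    [y]. *)
Lemma bits_neq (n : nat) (x y : 'I_(2 ^ n)) : x != y ->
  exists2 i, bits x i != bits y i & (bits x i == 1) = ~~ (bits y i == 1).
Proof.
move=> xy.
have [i xyi] : exists i, bits x i != bits y i.
  apply: contraPP (elimN eqP xy) => /forallNP H; rewrite not_notP.
  by apply: bits_inj => i; apply/eqP/negPn/negP/H.
exists i => //; move: xyi.
by case: (bits x i) (bits y i) => [[|[|?]] ?] [[|[|?]] ?].
Qed.

Section Tens.
Context {K : comPzRingType} {n : nat}.
Implicit Types A B : 'I_n -> 'M[K]_2.

Lemma eq_tens A B : A =1 B -> tens A = tens B.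
Proof. by move=> /funext ->. Qed.

Lemma tens1 : tens (fun _ : 'I_n => 1%:M) = 1%:M :> 'M[K]_(2 ^ n).
Proof.
apply/matrixP => x y; rewrite tensE !mxE.
have [->|xy] := eqVneq x y; first by rewrite big1 // => i _; rewrite mxE eqxx.
have [i xyi _] := bits_neq xy.
by rewrite (bigD1 i) //= mxE (negPf xyi) mul0r.
Qed.

Lemma tensM A B : tens A *m tens B = tens (fun i => A i *m B i).
Proof.
elim: n A B => [|m IH] A B /=; first by rewrite mulmx1.
(* With the factors generalized, destructing the equality of dimensions turns the casts into
   identities. *)
rewrite -IH -tensmx_mul; move: (tensmx _ _) (tensmx _ _).
by case: _ / (esym _) => M N; rewrite !castmx_id.
Qed.

Lemma tensZ (c : 'I_n -> K) A :
  tens (fun i => c i *: A i) = (\prod_i c i) *: tens A.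
Proof.
apply/matrixP => x y; rewrite mxE !tensE -big_split /=.
by apply: eq_bigr => i _; rewrite mxE.
Qed.
End Tens.


(** * Pauli matrices *)

Section SignCommute.
Context {K : comUnitRingType} {m : nat}.
Implicit Types A B : 'M[K]_m.

(** The sign is a boolean exponent, so that signs combine by exclusive or. *)
Definition scomm A B := exists s : bool, A *m B = (-1) ^+ s *: (B *m A).

Lemma scomm_sym A B : scomm A B -> scomm B A.
Proof.
by move=> [s AB]; exists s; rewrite AB scalerA -signr_addb addbb scale1r.
Qed.

Lemma scomm_scalar A (c : K) : scomm A c%:M.
Proof. by exists false; rewrite scale1r scalar_mxC. Qed.

Lemma scommM A B1 B2 : scomm A B1 -> scomm A B2 -> scomm A (B1 *m B2).
Proof.
move=> [s1 AB1] [s2 AB2]; exists (s1 (+) s2).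
by rewrite mulmxA AB1 -scalemxAl -mulmxA AB2 -scalemxAr scalerA mulmxA signr_addb.
Qed.

Lemma scommV A B : scomm A B -> scomm A (invmx B).
Proof.
move=> [s AB]; have [uB|nuB] := boolP (B \in unitmx); last first.
  (* By default [invmx] leaves a non-invertible matrix unchanged. *)
  by exists s; rewrite /invmx (negPf nuB).
exists s; rewrite -[LHS](mulKmx uB) [B *m _]mulmxA.
have -> : B *m A = (-1) ^+ s *: (A *m B).
  by rewrite AB scalerA -signr_addb addbb scale1r.
by rewrite -scalemxAl -scalemxAr mulmxK.
Qed.
End SignCommute.

(* [U^t*] typed at [R[i]] itself rather than at its closed-field structure:
   this keeps all products on one canonical path, which unification needs. *)
Definition adjmx {R : realType} {m : nat} (A : 'M[R[i]]_m) : 'M[R[i]]_m := A^t*.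

(** * Adjoints and unitary matrices *)

Section Unitary.
Context {R : realType} {m : nat}.
Implicit Types A B : 'M[R[i]]_m.

Lemma adjmxE A x y : adjmx A x y = Num.conj (A y x).
Proof. by rewrite !mxE. Qed.

Lemma adjmxM A B : adjmx (A *m B) = adjmx B *m adjmx A.
Proof.
apply/matrixP => x y; rewrite adjmxE !mxE rmorph_sum /=.
by apply: eq_bigr => z _; rewrite rmorphM /= mulrC !adjmxE.
Qed.

Lemma adjmxZ c A : adjmx (c *: A) = Num.conj c *: adjmx A.
Proof. by apply/matrixP => x y; rewrite adjmxE !mxE rmorphM. Qed.

Lemma adjmxK A : adjmx (adjmx A) = A.
Proof. by apply/matrixP => x y; rewrite !adjmxE conjCK. Qed.

Lemma adjmx_scalar c : adjmx (c%:M : 'M[R[i]]_m) = (Num.conj c)%:M.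
Proof. by apply/matrixP => x y; rewrite adjmxE !mxE rmorphMn /= eq_sym. Qed.

Lemma adjmx1 : adjmx (1%:M : 'M[R[i]]_m) = 1%:M.
Proof. by rewrite adjmx_scalar rmorph1. Qed.

Lemma unitaryP A : A \is unitarymx <-> A *m adjmx A = 1%:M.
Proof. by split=> [/unitarymxP|h]; last apply/unitarymxP. Qed.

Lemma unitaryK A : A \is unitarymx -> A *m adjmx A = 1%:M.
Proof. by move/unitaryP. Qed.

Lemma unitaryVK A : A \is unitarymx -> adjmx A *m A = 1%:M.
Proof. by move/unitaryK/mulmx1C. Qed.

Lemma unitary_adjmx A : A \is unitarymx -> adjmx A \is unitarymx.
Proof. by move/unitaryVK => h; apply/unitaryP; rewrite adjmxK. Qed.

Lemma unitaryM A B : A \is unitarymx -> B \is unitarymx -> A *m B \is unitarymx.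
Proof.
move=> /unitaryK uA /unitaryK uB; apply/unitaryP.
by rewrite adjmxM mulmxA -[A *m B *m _]mulmxA uB mulmx1.
Qed.

Lemma unitary_conj A B : A \is unitarymx -> B \is unitarymx ->
  A *m B *m adjmx A \is unitarymx.
Proof.
by move=> uA uB; apply: unitaryM; [exact: unitaryM | exact: unitary_adjmx].
Qed.

Lemma unitaryZ c A : `|c| = 1 -> A \is unitarymx -> c *: A \is unitarymx.
Proof.
move=> c1 /unitaryK uA; apply/unitaryP.
by rewrite adjmxZ -scalemxAl -scalemxAr scalerA uA -normCK c1 expr1n scale1r.
Qed.

(** Insert [adjmx A *m A] in front of [B], then move [A] across [B]. *)
Lemma sign_adjmx A B (e : bool) : A \is unitarymx ->
  A *m B = (-1) ^+ e *: (B *m A) ->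
  B *m adjmx A = (-1) ^+ e *: (adjmx A *m B).
Proof.
move=> uA AB; rewrite -[B in LHS]mul1mx -(unitaryVK uA) -[_ *m A *m B]mulmxA AB.
by rewrite -scalemxAr -scalemxAl -!mulmxA (unitaryK uA) mulmx1.
Qed.

Lemma invmx_adjmx A : A \is unitarymx -> invmx A = adjmx A.
Proof.
move=> uA; have [uAl _] := mulmx1_unit (unitaryK uA).
by rewrite -[LHS]mulmx1 -(unitaryK uA) mulKmx.
Qed.
End Unitary.

(** * Paulis on one qubit *)

Section OneQubit.
Context {R : realType}.
Local Notation C := R[i].
Implicit Types A B : 'M[C]_2.

Local Ltac mx2_entries :=
  apply/matrixP => -[[|[|?]] ?] [[|[|?]] ?] //=;
  rewrite !mxE !big_ord_recl !big_ord0 !mxE -?val_eqE /=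
    ?(mulr0n, mulr1n, mul0r, mulr0, mul1r, mulr1, addr0, add0r, expr0, expr1,
      mulN1r, oppr0, opprK) //.

Lemma mulXZ : pauliX *m pauliZ = (-1) *: (pauliZ *m pauliX) :> 'M[C]_2.
Proof. mx2_entries. Qed.

Lemma pauliX2 : pauliX *m pauliX = 1%:M :> 'M[C]_2.
Proof. mx2_entries. Qed.

Lemma pauliZ2 : pauliZ *m pauliZ = 1%:M :> 'M[C]_2.
Proof. mx2_entries. Qed.

Lemma adj_pauliX : adjmx pauliX = pauliX :> 'M[C]_2.
Proof. by apply/matrixP => i j; rewrite adjmxE !mxE rmorph_nat eq_sym. Qed.

Lemma adj_pauliZ : adjmx pauliZ = pauliZ :> 'M[C]_2.
Proof.
apply/matrixP => i j; rewrite adjmxE !mxE rmorphMn rmorphXn rmorphN1 eq_sym.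
by have [->|] := eqVneq i j.
Qed.

Lemma pauli1_unitary A : pauli1 A -> A \is unitarymx.
Proof.
elim=> {A} [||||A B _ UA _ UB|A _ UA].
- by apply/unitaryP; rewrite adjmx1 mulmx1.
- by apply/unitaryP; rewrite adjmx_scalar -scalar_mxM conjCi mulrN -expr2 sqrCi opprK.
- by apply/unitaryP; rewrite adj_pauliX pauliX2.
- by apply/unitaryP; rewrite adj_pauliZ pauliZ2.
- exact: unitaryM.
- by rewrite (invmx_adjmx UA); exact: unitary_adjmx.
Qed.

Lemma pauli1_adjmx A : pauli1 A -> pauli1 (adjmx A).
Proof. by move=> pA; rewrite -invmx_adjmx ?pauli1_unitary //; exact: pauli1_inv. Qed.

(** Commutation up to sign holds for scalars and passes to products and inverses. Used in both
    arguments, this leaves only pairs of generators to check. *)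
Lemma pauli1_scomm_gen (P B : 'M[C]_2) :
  scomm P pauliX -> scomm P pauliZ -> pauli1 B -> scomm P B.
Proof.
move=> PX PZ; elim=> {B} [|||| B1 B2 _ P1 _ P2|B1 _ P1].
- exact: scomm_scalar.
- exact: scomm_scalar.
- exact: PX.
- exact: PZ.
- exact: scommM P1 P2.
- exact: scommV P1.
Qed.

Lemma pauli1_scomm A B : pauli1 A -> pauli1 B -> scomm A B.
Proof.
move=> pA; apply: pauli1_scomm_gen; apply: scomm_sym; apply: pauli1_scomm_gen pA.
- by exists false; rewrite scale1r.
- by exists true; rewrite mulXZ.
- by apply: scomm_sym; exists true; rewrite mulXZ.
- by exists false; rewrite scale1r.
Qed.
End OneQubit.

(** * Paulis on n qubits and Z strings *)

Section Pauli.
Context {R : realType} {n : nat}.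
Local Notation C := R[i].
Implicit Types p q V W Z : 'M[C]_(2 ^ n).

Lemma adj_tens (A : 'I_n -> 'M[C]_2) : adjmx (tens A) = tens (fun i => adjmx (A i)).
Proof.
apply/matrixP => x y; rewrite adjmxE !tensE rmorph_prod.
by apply: eq_bigr => i _; rewrite adjmxE.
Qed.

Lemma tens_scomm (A B : 'I_n -> 'M[C]_2) (s : 'I_n -> bool) :
  (forall i, A i *m B i = (-1) ^+ s i *: (B i *m A i)) ->
  tens A *m tens B = (\prod_i (-1) ^+ s i) *: (tens B *m tens A).
Proof. by move=> AB; rewrite !tensM -tensZ; apply: eq_tens => i; rewrite AB. Qed.

Lemma prod_sign (I : Type) (r : seq I) (s : I -> bool) :
  exists t : bool, \prod_(i <- r) (-1) ^+ s i = (-1) ^+ t :> C.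
Proof.
elim/big_rec: _ => [|i x _ [t ->]]; first by exists false.
by exists (s i (+) t); rewrite signr_addb.
Qed.

Lemma pauli_scomm p q : pauli p -> pauli q -> scomm p q.
Proof.
move=> [A [pA ->]] [B [pB ->]].
have /fin_all_exists[s AB] i := pauli1_scomm (pA i) (pB i).
by have [t pt] := prod_sign (index_enum 'I_n) s; exists t; rewrite (tens_scomm AB) pt.
Qed.

Lemma pauli_unitary p : pauli p -> p \is unitarymx.
Proof.
move=> [A [pA ->]]; apply/unitaryP.
rewrite adj_tens tensM -tens1; apply: eq_tens => i.
exact/unitaryK/pauli1_unitary.
Qed.

Lemma pauli_adjmx p : pauli p -> pauli (adjmx p).
Proof.
move=> [A [pA ->]]; rewrite adj_tens; eexists; split; last by [].
by move=> q; apply: pauli1_adjmx.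
Qed.

Lemma pauliM p q : pauli p -> pauli q -> pauli (p *m q).
Proof.
move=> [A [pA ->]] [B [pB ->]]; rewrite tensM; eexists; split; last by [].
by move=> i; apply: pauli1_mul.
Qed.

Lemma pauli_1 : pauli (1%:M : 'M[C]_(2 ^ n)).
Proof.
by exists (fun=> 1%:M); split; [move=> _; exact: pauli1_one | rewrite tens1].
Qed.

Definition Xq (i : 'I_n) : 'M[C]_(2 ^ n) :=
  tens (fun j => if j == i then pauliX else 1%:M).
Definition Zq (i : 'I_n) : 'M[C]_(2 ^ n) :=
  tens (fun j => if j == i then pauliZ else 1%:M).

Lemma pauli_Xq i : pauli (Xq i).
Proof.
by eexists; split; last reflexivity; move=> j /=; case: ifP => _; constructor.
Qed.

Lemma pauli_Zq i : pauli (Zq i).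
Proof.
by eexists; split; last reflexivity; move=> j /=; case: ifP => _; constructor.
Qed.

Definition zstr (b : 'I_n -> bool) : 'M[C]_(2 ^ n) :=
  tens (fun i => if b i then pauliZ else 1%:M).

(** The character (-1)^{b.x} of (Z/2)^n: the eigenvalue of [zstr b] at the basis vector [x]. *)
Definition zval (b : 'I_n -> bool) (x : 'I_(2 ^ n)) : C :=
  \prod_i (-1) ^+ (b i && (bits x i == 1)).

Lemma zstrE b x y : zstr b x y = zval b x *+ (x == y).
Proof.
rewrite tensE; have [<-|xy] := eqVneq x y.
  apply: eq_bigr => i _; case: (b i); rewrite mxE eqxx //=.
  by case: (bits x i) => [[|[|?]] ?].
have [i xyi _] := bits_neq xy.
by rewrite (bigD1 i) //=; case: (b i); rewrite mxE (negPf xyi) mul0r.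
Qed.

Lemma Zq_zstr i : Zq i = zstr (fun j => j == i).
Proof. by []. Qed.

Lemma zval_Zq i x : zval (fun j => j == i) x = (-1) ^+ (bits x i == 1).
Proof.
rewrite /zval (bigD1 i) //= eqxx big1 ?mulr1 // => j /negPf -> //.
Qed.

(** If [x] and [y] differ at bit [i], comparing the entries at [x], [y] for [Zq i] gives
    [W x y = - W x y]. *)
Lemma commute_Z_diag W : (forall i, W *m Zq i = Zq i *m W) -> is_diag_mx W.
Proof.
move=> WZ; apply/is_diag_mxP => x y xy.
have [i _ xyi] := bits_neq xy.
have /matrixP/(_ x y) := WZ i; rewrite !mxE (bigD1 y) //= [in RHS](bigD1 x) //=.
rewrite !big1 => [|z zx|z zy]; last 2 first.
- by rewrite zstrE eq_sym (negPf zx) mul0r.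
- by rewrite zstrE (negPf zy) mulr0.
rewrite !addr0 !zstrE !eqxx !zval_Zq xyi mulrC.
case: (bits y i == 1); rewrite ?(expr0, expr1, mul1r, mulN1r) => /eqP.
  by rewrite eq_sym -addr_eq0 -mulr2n mulrn_eq0 => /eqP.
by rewrite -addr_eq0 -mulr2n mulrn_eq0 => /eqP.
Qed.

(** Commuting with every [Zq i] makes [W] diagonal. Commuting with [Xq i] equates diagonal entries
    whose indices differ only at bit [i], and such flips connect all indices. *)
Lemma commute_XZ_scalar W :
  (forall i, W *m Zq i = Zq i *m W) -> (forall i, W *m Xq i = Xq i *m W) ->
  exists c, W = c%:M.
Proof.
move=> /commute_Z_diag/diag_mxP[d ->] WX.
have flip i x y : bits x i != bits y i ->
    (forall j, j != i -> bits x j = bits y j) -> d 0 x = d 0 y.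
  move=> xyi xyj; have /matrixP/(_ x y) := WX i.
  rewrite mul_diag_mx mul_mx_diag !mxE.
  have -> : Xq i x y = 1; last by rewrite mulr1 mul1r.
  rewrite tensE (bigD1 i) //= eqxx mxE xyi mul1r big1 // => j ji.
  by rewrite (negPf ji) mxE xyj // eqxx.
have agree k x y : (forall i : 'I_n, k <= i -> bits x i = bits y i)%N -> d 0 x = d 0 y.
  elim: k x y => [|k IH] x y xy.
    by congr (d _ _); apply: bits_inj => i; exact: xy.
  (* [z] is [x] with bit [k] taken from [y]: one flip away from [x], and in agreement with [y] from
     bit [k] on. *)
  have [z zb] := bits_surj
    (fun i : 'I_n => if i == k :> nat then bits y i else bits x i).
  have -> : d 0 x = d 0 z.
    have [xz|/bits_neq[i xzi _]] := eqVneq x z; first by rewrite xz.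
    apply: (flip i) => // j ji; rewrite zb; case: eqP => // jk.
    move: xzi; rewrite zb; have [ik _|_] := eqVneq (i : nat) k; last by rewrite eqxx.
    by move: ji; rewrite -val_eqE /= jk ik eqxx.
  apply: IH => i; rewrite leq_eqVlt zb => /orP[/eqP ki|ki]; first by rewrite ki eqxx.
  by rewrite gtn_eqF // xy.
have [x0 _] := bits_surj (fun _ : 'I_n => ord0).
exists (d 0 x0); apply/matrixP => x y; rewrite !mxE; congr (_ *+ _).
by apply: (agree n) => i; rewrite leqNgt ltn_ord.
Qed.

(** The Pauli [P] with the same signs as [V] has an X where [V] anticommutes with [Zq i] and a Z
    where it anticommutes with [Xq i]. Then [adjmx P *m V] commutes with all generators, hence is
    scalar. *)
Lemma sign_commute_pauli V :
  (forall i, scomm V (Zq i)) -> (forall i, scomm V (Xq i)) ->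
  exists c, exists2 p, pauli p & V = c *: p.
Proof.
move=> /fin_all_exists[s VZ] /fin_all_exists[t VX].
pose P : 'M[C]_(2 ^ n) := tens (fun i =>
  (if s i then pauliX else 1%:M) *m (if t i then pauliZ else 1%:M)).
have pP : pauli P.
  eexists; split; last reflexivity.
  by move=> i; apply: pauli1_mul; case: ifP => _; constructor.
have sgn (u : 'I_n -> bool) i :
    \prod_(j < n) (-1) ^+ (u j && (j == i)) = (-1) ^+ u i :> C.
  by rewrite (bigD1 i) //= eqxx andbT big1 ?mulr1 // => j /negPf ->; rewrite andbF.
have PZ i : P *m Zq i = (-1) ^+ s i *: (Zq i *m P).
  rewrite -(sgn s); apply: tens_scomm => j.
  case: eqP => _; rewrite ?andbF ?andbT ?scale1r ?mulmx1 ?mul1mx //.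
  have tZ : (if t j then pauliZ else 1%:M) *m pauliZ =
      pauliZ *m (if t j then pauliZ else 1%:M : 'M[C]_2).
    by case: (t j); rewrite ?mulmx1 ?mul1mx.
  rewrite -mulmxA tZ !mulmxA; case: (s j); last by rewrite mulmx1 mul1mx scale1r.
  by rewrite mulXZ -scalemxAl.
have PX i : P *m Xq i = (-1) ^+ t i *: (Xq i *m P).
  rewrite -(sgn t); apply: tens_scomm => j.
  case: eqP => _; rewrite ?andbF ?andbT ?scale1r ?mulmx1 ?mul1mx //.
  have sX : (if s j then pauliX else 1%:M) *m pauliX =
      pauliX *m (if s j then pauliX else 1%:M : 'M[C]_2).
    by case: (s j); rewrite ?mulmx1 ?mul1mx.
  rewrite [X in _ *: X]mulmxA -sX -!mulmxA scalemxAr; congr (_ *m _).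
  case: (t j); last by rewrite mulmx1 mul1mx scale1r.
  by rewrite mulXZ !scaleN1r opprK.
have uP := pauli_unitary pP.
have PPV : P *m (adjmx P *m V) = V by rewrite mulmxA (unitaryK uP) mul1mx.
have PtP := unitaryVK uP.
have WA (A : 'M[C]_(2 ^ n)) (e : bool) : V *m A = (-1) ^+ e *: (A *m V) ->
    P *m A = (-1) ^+ e *: (A *m P) -> adjmx P *m V *m A = A *m (adjmx P *m V).
  move=> VA PA.
  have AP := sign_adjmx uP PA.
  by rewrite [RHS]mulmxA AP -scalemxAl -!mulmxA VA -scalemxAr.
have [c Wc] : exists c, adjmx P *m V = c%:M.
  by apply: commute_XZ_scalar => i; apply: WA.
by exists c, P; rewrite // -PPV Wc mul_mx_scalar.
Qed.
End Pauli.

(** * The Clifford hierarchy *)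

Section Hierarchy.
Context {R : realType} {n : nat}.
Local Notation C := R[i].
Implicit Types p q U V : 'M[C]_(2 ^ n).

Lemma CHSS k U :
  CH k.+2 U <-> U \is unitarymx /\ forall p, pauli p -> CH k.+1 (U *m p *m adjmx U).
Proof. by []. Qed.

Lemma cliffordP U :
  clifford U <-> U \is unitarymx /\ forall p, pauli p -> CH 1 (U *m p *m adjmx U).
Proof. by []. Qed.

Lemma CH1_pauli p : pauli p -> CH 1 p.
Proof. by move=> pp; exists p => //; exists 1; rewrite ?normr1 ?scale1r. Qed.

Lemma conjmxZ c U V : `|c| = 1 ->
  (c *: U) *m V *m adjmx (c *: U) = U *m V *m adjmx U.
Proof.
move=> c1; rewrite adjmxZ -!scalemxAl -scalemxAr scalerA -normCK c1 expr1n.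
by rewrite scale1r.
Qed.

Lemma CH_phase k c U : `|c| = 1 -> CH k U -> CH k (c *: U).
Proof.
move=> c1; case: k => [[]|[|k]].
  move=> [p pp [d d1 ->]]; exists p => //; exists (c * d).
    by rewrite normrM c1 d1 mulr1.
  by rewrite scalerA.
move=> /CHSS[uU HU]; apply/CHSS; split; first exact: unitaryZ.
by move=> p pp; rewrite conjmxZ //; exact: HU.
Qed.

Lemma CH_unitary k U : CH k U -> U \is unitarymx.
Proof.
case: k => [[]|[|k]]; last by case.
by move=> [p pp [c c1 ->]]; apply: unitaryZ => //; exact: pauli_unitary.
Qed.

Lemma norm_sign (s : bool) : `|(-1) ^+ s : C| = 1.
Proof. by rewrite normrX normrN1 expr1n. Qed.

Lemma unitary_scale_norm c V : c *: V \is unitarymx -> V \is unitarymx -> `|c| = 1.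
Proof.
move=> /unitaryK; rewrite adjmxZ -scalemxAl -scalemxAr scalerA => h /unitaryK VV.
move: h; rewrite VV -normCK => /matrixP.
have [x _] := bits_surj (fun _ : 'I_n => ord0).
by move=> /(_ x x); rewrite !mxE eqxx mulr1 => /eqP; rewrite sqrp_eq1 // => /eqP.
Qed.

(** Allows level one to be tested by signs, without exhibiting a Pauli. In the converse, unitarity
    forces the scalar found by [sign_commute_pauli] to be a phase. *)
Lemma CH1_scomm V : CH 1 V <->
  V \is unitarymx /\ forall p, pauli p -> scomm V p.
Proof.
split=> [HV|[uV VP]].
  split; first exact: CH_unitary HV.
  case: HV => q pq [c c1 ->] p pp.
  have [s qs] := pauli_scomm pq pp; exists s.
  by rewrite -scalemxAl qs -scalemxAr !scalerA mulrC.
have [c [p pp Vp]] : exists c, exists2 p, pauli p & V = c *: p.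
  by apply: sign_commute_pauli => i; apply: VP; [exact: pauli_Zq|exact: pauli_Xq].
exists p => //; exists c => //.
by apply: (@unitary_scale_norm c p); [rewrite -Vp | exact: pauli_unitary].
Qed.

Lemma scomm_conj p q : scomm p q -> p \is unitarymx ->
  exists s : bool, p *m q *m adjmx p = (-1) ^+ s *: q.
Proof.
move=> [s pq] up; exists s.
by rewrite pq -scalemxAl -mulmxA (unitaryK up) mulmx1.
Qed.

(** Commuting [adjmx U *m q *m U] past [p] amounts to commuting [q] past [U *m p *m adjmx U], a
    Pauli up to phase; so the sign test for level one applies. *)
Lemma clifford_adjmx U : clifford U -> clifford (adjmx U).
Proof.
move=> /cliffordP[uU HU]; apply/cliffordP; split; first exact: unitary_adjmx.
move=> q pq; apply/CH1_scomm; rewrite adjmxK; split.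
  apply: unitaryM; last exact: uU.
  by apply: unitaryM; [exact: unitary_adjmx | exact: pauli_unitary].
move=> p pp; have [r pr [c c1 Ur]] := HU p pp.
have Up : U *m p = c *: (r *m U).
  by rewrite scalemxAl -Ur -mulmxA (unitaryVK uU) mulmx1.
have pU : p *m adjmx U = c *: (adjmx U *m r).
  by rewrite scalemxAr -Ur !mulmxA (unitaryVK uU) mul1mx.
have [s qr] := pauli_scomm pq pr; exists s.
rewrite -!mulmxA Up -!scalemxAr (mulmxA q r U) qr (mulmxA p (adjmx U)) pU.
by rewrite -!scalemxAl -scalemxAr !scalerA -!mulmxA mulrC.
Qed.

(** Conjugating [p] by the new gate is conjugating by [V] the operator [adjmx U *m p *m U], a Pauli
    up to phase, and then by [U]; the induction hypothesis handles the outer conjugation. *)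
Lemma CH_conj k U V : clifford U -> CH k.+1 V -> CH k.+1 (U *m V *m adjmx U).
Proof.
move=> cU; have [uU HU] := (cliffordP _).1 cU; elim: k V => [|k IH] V.
  move=> [p pp [c c1 ->]]; rewrite -scalemxAr -scalemxAl.
  by apply: CH_phase => //; exact: HU.
move=> /CHSS[uV HV]; apply/CHSS; split.
  exact: unitary_conj.
move=> p pp; have [_ HU'] := (cliffordP _).1 (clifford_adjmx cU).
have [q pq [c c1 Uq]] := HU' p pp; rewrite adjmxK in Uq.
have -> : U *m V *m adjmx U *m p *m adjmx (U *m V *m adjmx U) =
    U *m (c *: (V *m q *m adjmx V)) *m adjmx U.
  by rewrite scalemxAl scalemxAr -Uq !adjmxM adjmxK !mulmxA.
by apply: IH; apply: CH_phase => //; exact: HV.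
Qed.

(** [U] only replaces the conjugated Pauli by another one, up to phase. The level starts at two
    because a Pauli times a Clifford need not be a Pauli. *)
Lemma CH_cliffordr k U V : clifford U -> CH k.+2 V -> CH k.+2 (V *m U).
Proof.
move=> /cliffordP[uU HU] /CHSS[uV HV]; apply/CHSS; split; first exact: unitaryM.
move=> p pp; have [q pq [c c1 Uq]] := HU p pp.
have -> : V *m U *m p *m adjmx (V *m U) = c *: (V *m q *m adjmx V).
  by rewrite scalemxAl scalemxAr -Uq adjmxM !mulmxA.
by apply: CH_phase => //; exact: HV.
Qed.

Lemma CH_cliffordl k U V : clifford U -> CH k.+2 V -> CH k.+2 (U *m V).
Proof.
move=> cU /CHSS[uV HV]; have uU := CH_unitary cU.
apply/CHSS; split; first exact: unitaryM.
move=> p pp; rewrite adjmxM.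
have -> : U *m V *m p *m (adjmx V *m adjmx U) = U *m (V *m p *m adjmx V) *m adjmx U.
  by rewrite !mulmxA.
exact/CH_conj/HV.
Qed.

(** Conjugation by [p] changes a Pauli only by a sign. Unlike for Clifford factors, level one is
    included, which the inductions on diagonal gates rely on. *)
Lemma CH_paulir k p V : pauli p -> CH k.+1 V -> CH k.+1 (V *m p).
Proof.
move=> pp; case: k => [[q pq [c c1 ->]]|k].
  rewrite -scalemxAl; apply: CH_phase => //; exact/CH1_pauli/pauliM.
move=> /CHSS[uV HV]; have up := pauli_unitary pp.
apply/CHSS; split; first exact: unitaryM.
move=> q pq; have [s ps] := scomm_conj (pauli_scomm pp pq) up.
have -> : V *m p *m q *m adjmx (V *m p) = (-1) ^+ s *: (V *m q *m adjmx V).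
  by rewrite scalemxAl scalemxAr -ps adjmxM !mulmxA.
by apply: CH_phase; [exact: norm_sign | exact: HV].
Qed.

(** At the base, a gate of level one sends each Pauli to itself up to sign. *)
Lemma CH_succ k U : CH k.+1 U -> CH k.+2 U.
Proof.
elim: k U => [|k IH] U.
  move=> /CH1_scomm[uU HU]; apply/CHSS; split; first exact: uU.
  move=> p pp.
  have [s ->] := scomm_conj (HU p pp) uU.
  by apply: CH_phase; [exact: norm_sign | exact: CH1_pauli].
move=> /CHSS[uU HU]; apply/CHSS; split; first exact: uU.
by move=> p pp; apply: IH; exact: HU.
Qed.
End Hierarchy.

(** * Diagonal gates *)

Section Diagonal.
Context {R : realType} {n : nat}.
Local Notation C := R[i].
Implicit Types p q D G : 'M[C]_(2 ^ n).

(** The parity b.x as a boolean, so that the same sign can be read in [R], for angles, and in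
    [R[i]], for entries. *)
Definition zsign (b : 'I_n -> bool) (x : 'I_(2 ^ n)) : bool :=
  \big[addb/false]_i (b i && (bits x i == 1)).

Lemma sign_zsign (K : pzRingType) b x :
  (-1) ^+ zsign b x = \prod_i (-1) ^+ (b i && (bits x i == 1)) :> K.
Proof.
by apply: (big_morph (fun c : bool => (-1) ^+ c)) => [c d|]; rewrite ?signr_addb.
Qed.

Definition diagf (f : 'I_(2 ^ n) -> C) : 'M[C]_(2 ^ n) := diag_mx (\row_x f x).

Lemma diagfE f x y : diagf f x y = f x *+ (x == y).
Proof. by rewrite !mxE. Qed.

Lemma eq_diagf f g : f =1 g -> diagf f = diagf g.
Proof. by move=> /funext ->. Qed.

Lemma diagf1 : diagf (fun _ => 1) = 1%:M.
Proof. by apply/matrixP => x y; rewrite diagfE mxE. Qed.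

Lemma diagfM f g : diagf f *m diagf g = diagf (fun x => f x * g x).
Proof.
apply/matrixP => x y; rewrite /diagf mul_diag_mx !mxE.
by have [->|] := eqVneq x y; rewrite ?mulr1n // mulr0.
Qed.

Lemma diagfX f k : diagf f ^+ k = diagf (fun x => f x ^+ k).
Proof.
elim: k => [|k IH]; first exact/esym/diagf1.
by rewrite exprS IH -mulmxE diagfM; apply: eq_diagf => x; rewrite exprS.
Qed.

Lemma prod_diagf (I : Type) (r : seq I) (P : pred I) (F : I -> 'I_(2 ^ n) -> C) :
  \prod_(j <- r | P j) diagf (F j) = diagf (fun x => \prod_(j <- r | P j) F j x).
Proof.
elim: r => [|j r IH].
  rewrite big_nil; apply: (etrans (esym diagf1)).
  by apply: eq_diagf => x; rewrite big_nil.
rewrite big_cons; case: ifP => Pj.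
  rewrite IH -mulmxE diagfM; apply: eq_diagf => x; by rewrite big_cons Pj.
by rewrite IH; apply: eq_diagf => x; rewrite big_cons Pj.
Qed.

Lemma adj_diagf f : adjmx (diagf f) = diagf (fun x => Num.conj (f x)).
Proof.
apply/matrixP => x y; rewrite adjmxE !diagfE rmorphMn eq_sym.
by have [->|] := eqVneq x y.
Qed.

Lemma zstr_diagf b : zstr b = diagf (fun x => (-1) ^+ zsign b x).
Proof. by apply/matrixP => x y; rewrite zstrE diagfE sign_zsign. Qed.

Lemma zstr2 b : zstr b *m zstr b = 1%:M :> 'M[C]_(2 ^ n).
Proof.
rewrite zstr_diagf diagfM -diagf1; apply: eq_diagf => x.
by rewrite -signr_addb addbb.
Qed.

Lemma pauliZ_stringP Z : pauliZ_string Z <-> exists b, Z = zstr b :> 'M[C]_(2 ^ n).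
Proof.
split=> [[A [AZ ->]]|[b ->]]; last first.
  eexists; split; last reflexivity.
  by move=> q /=; case: ifP => _; [right | left].
have /fin_all_exists[b Ab] (i : 'I_n) :
    exists b : bool, A i = if b then pauliZ else 1%:M.
  by case: (AZ i) => ->; [exists false | exists true].
by exists b; apply: eq_tens.
Qed.

Lemma pauli_zstr b : pauli (zstr b : 'M[C]_(2 ^ n)).
Proof.
eexists; split; last reflexivity.
by move=> q /=; case: ifP => _; constructor.
Qed.

Lemma zstr_nonid (b : 'I_n -> bool) i :
  b i -> nonid_pauliZ_string (zstr b : 'M[C]_(2 ^ n)).
Proof.
move=> bi; split; first by apply/pauliZ_stringP; exists b.
(* At the basis vector whose only 1 is at bit [i], the string has eigenvalue -1. *)
have [x xb] := bits_surj (fun j : 'I_n => if j == i then 1 else 0).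
move=> /matrixP/(_ x x); rewrite zstr_diagf diagfE mxE eqxx.
have -> : zsign b x = true.
  rewrite /zsign (bigD1 i) //= xb eqxx bi big1 // => j /negPf ji.
  by rewrite xb ji andbF.
by move/eqP; rewrite expr1 mulr1n eq_sym -addr_eq0 -mulr2n pnatr_eq0.
Qed.

Lemma expi_zstr a b : expi a (zstr b) = diagf (fun x => cis (a * (-1) ^+ zsign b x)).
Proof.
rewrite /expi mxexp_involution ?zstr2 // zstr_diagf -diagf1.
apply/matrixP => x y; rewrite mxE [X in X + _]mxE [X in _ + X]mxE !diagfE.
have [_|] := eqVneq x y; last by rewrite !mulr0n !mulr0 addr0.
case: (zsign b x); rewrite ?(expr0, expr1, mulrN, mulr1n, mulr1, mulrN1) //.
by rewrite /cis cosN sinN rmorphN /= mulrN.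
Qed.

(** The exponent of the entry at [x] in a product of Z rotations, as a combination of characters of
    (Z/2)^n. *)
Definition angle m (b : 'I_m -> 'I_n -> bool) (t : 'I_m -> R) (x : 'I_(2 ^ n)) : R :=
  \sum_j t j * (-1) ^+ zsign (b j) x.

Lemma prod_expi m (b : 'I_m -> 'I_n -> bool) (t : 'I_m -> R) :
  \prod_(j < m) expi (t j) (zstr (b j)) = diagf (fun x => cis (angle b t x)).
Proof.
under eq_bigr do rewrite expi_zstr.
by rewrite prod_diagf; apply: eq_diagf => x; rewrite cis_sum.
Qed.

Lemma diagf_cis_unitary (g : 'I_(2 ^ n) -> R) :
  diagf (fun x => cis (g x)) \is unitarymx.
Proof.
apply/unitaryP; rewrite adj_diagf diagfM -diagf1; apply: eq_diagf => x.
by rewrite conj_cis -cisD subrr cis0.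
Qed.

Lemma conj_expi p b a (s : bool) :
  p \is unitarymx -> p *m zstr b = (-1) ^+ s *: (zstr b *m p) ->
  p *m expi a (zstr b) *m adjmx p = expi ((-1) ^+ s * a) (zstr b).
Proof.
move=> up ps; rewrite /expi !mxexp_involution ?zstr2 //.
rewrite mulmxDr mulmxDl -!scalemxAr mulmx1 -!scalemxAl (unitaryK up) ps.
rewrite -scalemxAl -mulmxA (unitaryK up) mulmx1.
case: s {ps} => /=; rewrite ?(expr1, expr0, mul1r, scale1r) // mulN1r cosN sinN.
by rewrite rmorphN /= mulrN scaleN1r scaleNr scalerN.
Qed.

(** [D *m p *m adjmx D] is [D *m (p *m adjmx D *m adjmx p)] times [p], and the first factor is a
    product of rotations along the same strings with angles 0 or [2 * t j]. *)
Lemma dyadic_CH d m (b : 'I_m -> 'I_n -> bool) (t : 'I_m -> R) :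
  (forall j, exists z : int, t j = z%:~R * pi / 2 ^+ d) ->
  CH d.+1 (\prod_(j < m) expi (t j) (zstr (b j))).
Proof.
elim: d t => [|d IH] t td.
  (* For [d = 0] the angles are multiples of [pi], so every rotation is 1 or -1. *)
  have [e ee] : exists e : bool,
      \prod_(j < m) expi (t j) (zstr (b j)) = (-1) ^+ e *: 1%:M.
    elim/big_rec: _ => [|j x _ [e ->]]; first by exists false; rewrite scale1r.
    have [z ->] := td j; rewrite expr0 divr1 expi_zstr.
    have -> : diagf (fun x => cis (z%:~R * pi * (-1) ^+ zsign (b j) x)) =
        cis (z%:~R * pi) *: 1%:M.
      rewrite -diagf1; apply/matrixP => y y'; rewrite diagfE [RHS]mxE diagfE.
      case: (y == y'); rewrite ?mulr1n ?mulr0n ?mulr0 // mulr1.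
      case: (zsign _ _); rewrite ?expr0 ?mulr1 // expr1 mulrN1 -conj_cis.
      by case: (@cis_intpi R z) => ->; rewrite ?rmorphN rmorph1.
    rewrite -mulmxE -scalemxAl mul1mx scalerA.
    case: (@cis_intpi R z) => ->; first by exists e; rewrite mul1r.
    by exists (~~ e); rewrite mulN1r; case: (e); rewrite ?expr1 ?expr0 ?opprK.
  by rewrite ee; apply: CH_phase; [exact: norm_sign | exact/CH1_pauli/pauli_1].
apply/CHSS; split; first by rewrite (prod_expi b t); exact: diagf_cis_unitary.
move=> p pp; have up := pauli_unitary pp.
have /fin_all_exists[s ps] j := pauli_scomm pp (pauli_zstr (b j)).
have := prod_expi b t; move: (\prod_(j < m) _) => D DE.
have Dadj : adjmx D = \prod_(j < m) expi (- t j) (zstr (b j)).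
  rewrite DE adj_diagf (prod_expi b (fun j => - t j)).
  apply: eq_diagf => x; rewrite conj_cis; congr cis.
  by rewrite /angle -sumrN; apply: eq_bigr => j _; rewrite mulNr.
have pDp : p *m adjmx D *m adjmx p =
    \prod_(j < m) expi ((-1) ^+ s j * - t j) (zstr (b j)).
  rewrite Dadj (big_morph (fun A : 'M[C]_(2 ^ n) => p *m A *m adjmx p)
    (id1 := 1) (op1 := *%R)).
  - by apply: eq_bigr => j _; exact: conj_expi.
  - move=> A B; rewrite -!mulmxE !mulmxA -[_ *m adjmx p *m p]mulmxA.
    by rewrite (unitaryVK up) mulmx1.
  - by rewrite mulmx1 (unitaryK up).
have -> : D *m p *m adjmx D = D *m (p *m adjmx D *m adjmx p) *m p.
  by rewrite !mulmxA -[_ *m adjmx p *m p]mulmxA (unitaryVK up) mulmx1.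
apply: CH_paulir => //.
have -> : D *m (p *m adjmx D *m adjmx p) =
    \prod_(j < m) expi (t j + (-1) ^+ s j * - t j) (zstr (b j)).
  rewrite (etrans pDp (prod_expi b (fun j => (-1) ^+ s j * - t j))) DE diagfM.
  rewrite (prod_expi b (fun j => t j + (-1) ^+ s j * - t j)).
  apply: eq_diagf => x; rewrite -cisD; congr cis.
  by rewrite /angle -big_split /=; apply: eq_bigr => j _; rewrite mulrDl.
apply: IH => j; have [z tz] := td j.
have e2 : 2 ^+ d != 0 :> R by rewrite expf_neq0 // pnatr_eq0.
(* If [p] commutes with the string, the angle cancels; otherwise it doubles, which removes one
   factor 2 from the denominator. *)
case: (s j); rewrite ?expr0 ?expr1; last by exists 0; rewrite !mul1r subrr !mul0r.
by exists z; rewrite tz exprS; field.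
Qed.

(** The sign occurs twice in moving [G *m G] past a Pauli, so the square commutes with all of
    them. *)
Lemma scomm_sqr_scalar G : (forall q, pauli q -> scomm G q) ->
  exists c, G *m G = c%:M.
Proof.
move=> GP.
have G2 q : pauli q -> G *m G *m q = q *m (G *m G).
  move=> /GP[s Gq]; rewrite -mulmxA Gq -scalemxAr (mulmxA G q G) Gq -scalemxAl scalerA.
  by rewrite -signr_addb addbb scale1r mulmxA.
by apply: commute_XZ_scalar => i; apply: G2; [exact: pauli_Zq | exact: pauli_Xq].
Qed.

Lemma is_diag_diagf D : is_diag_mx D -> exists f, D = diagf f.
Proof.
move=> /diag_mxP[d ->]; exists (fun x => d 0 x).
by congr diag_mx; apply/rowP => x; rewrite mxE.
Qed.

(** Moving [Zq i] through [p] and [adjmx p] produces the same sign twice, so the conjugate still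
    commutes with every [Zq i]. *)
Lemma pauli_conj_diagf p f : pauli p -> exists g, p *m diagf f *m adjmx p = diagf g.
Proof.
move=> pp; have up := pauli_unitary pp; apply: is_diag_diagf.
apply: commute_Z_diag => i.
have [s pZ] := pauli_scomm pp (pauli_Zq i).
have pZ' := sign_adjmx up pZ.
have Zd : Zq i *m diagf f = diagf f *m Zq i.
  by rewrite Zq_zstr zstr_diagf !diagfM; apply: eq_diagf => x; rewrite mulrC.
have {}pZ' : adjmx p *m Zq i = (-1) ^+ s *: (Zq i *m adjmx p).
  by rewrite pZ' scalerA -signr_addb addbb scale1r.
rewrite -mulmxA pZ' -scalemxAr (mulmxA _ (Zq i)) -(mulmxA p (diagf f)).
rewrite -Zd (mulmxA p) pZ.
by rewrite -!scalemxAl scalerA -signr_addb addbb scale1r !mulmxA.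
Qed.
End Diagonal.

(** * From the hierarchy to dyadic rotations *)

Section Converse.
Context {R : realType} {n : nat}.
Local Notation C := R[i].
Implicit Types p q D G : 'M[C]_(2 ^ n).

Lemma conj_expr p D k : p \is unitarymx ->
  p *m D ^+ k *m adjmx p = (p *m D *m adjmx p) ^+ k.
Proof.
move=> up; elim: k => [|k IH]; first by rewrite !expr0 mulmx1 (unitaryK up).
rewrite !exprS -IH -!mulmxE !mulmxA -[_ *m adjmx p *m p]mulmxA (unitaryVK up).
by rewrite mulmx1.
Qed.

(* If [D p D^* p^*] has scalar power [c], then [G = D ^+ N] satisfies
   [G p = c p G]; applying this twice to the scalar [p p] gives [c ^+ 2 = 1]. *)
Lemma power_scomm (f : 'I_(2 ^ n) -> C) p N c :
  diagf f \is unitarymx -> pauli p ->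
  (diagf f *m p *m adjmx (diagf f) *m adjmx p) ^+ N = c%:M ->
  scomm (diagf f ^+ N) p.
Proof.
move=> uD pp; have up := pauli_unitary pp.
set G := diagf f ^+ N.
have uG : G *m adjmx G = 1%:M.
  have := unitaryK uD; rewrite /G diagfX !adj_diagf !diagfM => ff.
  transitivity ((1%:M : 'M[C]_(2 ^ n)) ^+ N); last exact: expr1n.
  rewrite -ff diagfX; apply: eq_diagf => x; by rewrite rmorphXn exprMn.
have [g pg] := pauli_conj_diagf (fun x => Num.conj (f x)) pp.
have -> : diagf f *m p *m adjmx (diagf f) *m adjmx p =
    diagf f *m (p *m adjmx (diagf f) *m adjmx p).
  by rewrite !mulmxA.
have adjG : adjmx G = adjmx (diagf f) ^+ N.
  rewrite /G adj_diagf !diagfX adj_diagf; apply: eq_diagf => x; exact: rmorphXn.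
(* Both factors are diagonal, hence commute, and the power distributes. *)
have -> : (diagf f *m (p *m adjmx (diagf f) *m adjmx p)) ^+ N =
    G *m (p *m adjmx G *m adjmx p).
  rewrite adjG conj_expr // adj_diagf pg diagfM /G !diagfX diagfM.
  by apply: eq_diagf => x; rewrite exprMn.
move=> Gc.
have Gp : G *m p = c *: (p *m G).
  have /(congr1 (fun A => A *m (p *m G))) := Gc.
  rewrite mul_scalar_mx => <-.
  rewrite -!mulmxA (mulmxA (adjmx p)) (unitaryVK up) mul1mx (mulmx1C uG).
  by rewrite mulmx1.
have [l pl] := scomm_sqr_scalar (fun q pq => pauli_scomm pp pq).
have l0 : l != 0.
  apply/eqP => l0; have /unitaryK := unitaryM up up.
  rewrite pl l0 raddf0 mul0mx => /matrixP.
  have [x _] := bits_surj (fun _ : 'I_n => ord0).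
  by move=> /(_ x x)/eqP; rewrite !mxE eqxx eq_sym oner_eq0.
have c2 : c ^+ 2 = 1.
  have : G *m (p *m p) = (c ^+ 2) *: ((p *m p) *m G).
    by rewrite mulmxA Gp -scalemxAl -mulmxA Gp -scalemxAr scalerA mulmxA.
  rewrite pl mul_mx_scalar mul_scalar_mx => /(congr1 (fun A => A *m adjmx G)).
  rewrite -!scalemxAl uG scalerA => /matrixP.
  have [x _] := bits_surj (fun _ : 'I_n => ord0).
  move=> /(_ x x); rewrite !mxE eqxx !mulr1 => /esym/eqP.
  by rewrite -subr_eq0 -{2}[l]mul1r -mulrBl mulf_eq0 (negPf l0) orbF subr_eq0 => /eqP.
move/eqP: c2; rewrite sqrf_eq1 => /orP[] /eqP cE.
  by exists false; rewrite expr0 Gp cE.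
by exists true; rewrite expr1 Gp cE.
Qed.

(** Each level costs one squaring: the induction hypothesis for [D *m p *m adjmx D *m adjmx p] makes
    [D ^+ (2 ^ k.+1)] commute up to sign with each Pauli [p], and its square is then scalar. *)
Lemma CH_power_scalar k (f : 'I_(2 ^ n) -> C) : CH k.+1 (diagf f) ->
  exists c, diagf f ^+ (2 ^ k.+1) = c%:M.
Proof.
elim: k f => [|k IH] f.
  by move=> /CH1_scomm[_]; exact: scomm_sqr_scalar.
move=> /CHSS[uD HD]; rewrite expnS mulnC exprM expr2 -mulmxE.
apply: scomm_sqr_scalar => p pp; have up := pauli_unitary pp.
have [g pg] := pauli_conj_diagf (fun x => Num.conj (f x)) pp.
have DE : diagf f *m p *m adjmx (diagf f) *m adjmx p = diagf (fun x => f x * g x).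
  by rewrite -diagfM -pg -adj_diagf !mulmxA.
have [c cE] : exists c, diagf (fun x => f x * g x) ^+ (2 ^ k.+1) = c%:M.
  by apply: IH; rewrite -DE; apply: CH_paulir; [exact: pauli_adjmx | exact: HD].
by apply: (@power_scomm f p _ c) => //; rewrite DE.
Qed.

(** Orthogonality of characters: the sum over [b] factors over the qubits, with factor 2 where the
    bits agree and 0 where they differ. *)
Lemma zsign_orthogonal x y :
  \sum_(b : {ffun 'I_n -> bool}) (-1) ^+ zsign b y * (-1) ^+ zsign b x
    = (2 ^+ n) *+ (x == y) :> R.
Proof.
under eq_bigr do rewrite !sign_zsign -big_split /=.
rewrite -(bigA_distr_bigA (fun i c =>
  (-1) ^+ (c && (bits y i == 1)) * (-1) ^+ (c && (bits x i == 1)))).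
have [<-|xy] := eqVneq x y.
  rewrite mulr1n -[in RHS](card_ord n) -prodr_const.
  apply: eq_bigr => i _; rewrite big_bool /= !expr0 mulr1.
  by rewrite -signr_addb addbb expr0.
have [i _ xyi] := bits_neq xy.
rewrite mulr0n (bigD1 i) //= big_bool /= !expr0 mulr1 xyi.
by case: (bits y i == 1); rewrite ?expr0 ?expr1 ?mulr1 ?mul1r addNr mul0r.
Qed.

(** Fourier inversion with one rotation for each pair of a basis index [w] and a string [b]; pairs
    with the same string are not merged. Normalization by [2 ^+ n] raises the denominator to
    [2 ^+ (d + n)]. *)
Lemma dyadic_diagonal (d : nat) (z : 'I_(2 ^ n) -> int) : (0 < d)%N ->
  exists (m : nat) (alpha : 'I_m -> int) (k : 'I_m -> nat) (Z : 'I_m -> 'M[C]_(2 ^ n)),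
    [/\ forall j, (0 < k j)%N, forall j, nonid_pauliZ_string (Z j) &
        exists2 c, `|c| = 1 &
          diagf (fun x => cis ((z x)%:~R * (pi *+ 2) / 2 ^+ d)) =
          c *: \prod_(j < m) expi ((alpha j)%:~R * pi / 2 ^+ k j) (Z j)].
Proof.
move=> d0.
pose I : finType := ('I_(2 ^ n) * {ffun 'I_n -> bool})%type.
(* Only nonzero [b] give non-identity strings; the remaining pairs make up the global phase. *)
pose A := [pred t : I | [exists i, t.2 i]].
(* The factor 2 comes from [pi *+ 2]. *)
pose al (t : I) : int := z t.1 * (-1) ^+ zsign t.2 t.1 * 2.
pose th (t : I) : R := (al t)%:~R * pi / 2 ^+ (d + n).
pose e (j : 'I_#|A|) : I := enum_val j.
exists #|A|, (fun j => al (e j)), (fun=> (d + n)%N), (fun j => zstr (e j).2).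
split.
- by move=> j; rewrite addn_gt0 d0.
- move=> j; have /existsP[i bi] : e j \in A by exact: enum_valP.
  exact: zstr_nonid bi.
exists (cis (\sum_(t | t \notin A) th t)); first exact: norm_cis.
rewrite (@prod_expi R n _ (fun j => (e j).2) (fun j => th (e j))).
apply/matrixP => x y; rewrite diagfE [RHS]mxE diagfE [RHS]mulrnAr; congr (_ *+ _).
rewrite -cisD; congr cis; rewrite /angle.
(* For [b = 0] the character is constantly 1, so it may be inserted to complete the Fourier sum. *)
have thA t : t \notin A -> th t = th t * (-1) ^+ zsign t.2 x.
  move=> tA; suff -> : zsign t.2 x = false by rewrite expr0 mulr1.
  rewrite /zsign big1 // => i _; case: (boolP (t.2 i)) => // ti.
  by case/negP: tA; apply/existsP; exists i.
rewrite (eq_bigr _ thA).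
have -> : \sum_j th (e j) * (-1) ^+ zsign (e j).2 x =
    \sum_(t in A) th t * (-1) ^+ zsign t.2 x.
  by rewrite [RHS]big_enum_val.
rewrite addrC; transitivity (\sum_t th t * (-1) ^+ zsign t.2 x); last first.
  by rewrite (bigID [in A]).
rewrite -(pair_bigA _ (fun y b => th (y, b) * (-1) ^+ zsign b x)) /=.
have inner w : \sum_(b : {ffun 'I_n -> bool}) th (w, b) * (-1) ^+ zsign b x =
    (z w)%:~R * (pi *+ 2) / 2 ^+ d *+ (x == w).
  transitivity ((z w)%:~R * ((pi : R) *+ 2) / 2 ^+ (d + n) *
      \sum_(b : {ffun 'I_n -> bool}) (-1) ^+ zsign b w * (-1) ^+ zsign b x).
    rewrite mulr_sumr; apply: eq_bigr => b _.
    rewrite /th /al !rmorphM rmorphXn rmorphN1 /=; ring.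
  rewrite zsign_orthogonal mulrnAr; congr (_ *+ _).
  have e2 k : 2 ^+ k != 0 :> R by rewrite expf_neq0 // pnatr_eq0.
  by rewrite exprD; field; rewrite !e2.
rewrite (eq_bigr _ (fun w _ => inner w)) (bigD1 x) //= eqxx mulr1n big1 ?addr0 //.
by move=> w /negPf wx; rewrite eq_sym wx.
Qed.
End Converse.

(** * Removal of the Clifford factors and the equivalence *)

Lemma CH_cliffordK (R : realType) (n k : nat) (C1 C2 D : 'M[R[i]]_(2 ^ n)) :
  clifford C1 -> clifford C2 -> CH k.+2 (C1 *m D *m C2) -> CH k.+2 D.
Proof.
move=> cC1 cC2 HU.
have -> : D = adjmx C1 *m (C1 *m D *m C2) *m adjmx C2.
  rewrite !mulmxA (unitaryVK (CH_unitary cC1)) mul1mx -mulmxA.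
  by rewrite (unitaryK (CH_unitary cC2)) mulmx1.
apply: CH_cliffordr; first exact: clifford_adjmx.
by apply: CH_cliffordl; first exact: clifford_adjmx.
Qed.

(** All entries have the same power of order [2 ^ k.+1], so their quotients by the entry at a fixed
    [x0] are roots of unity. *)
Lemma CH_diagonal_roots (R : realType) (n k : nat) (g : 'I_(2 ^ n) -> R) :
  CH k.+1 (diagf (fun x => cis (g x))) ->
  exists (a : R) (z : 'I_(2 ^ n) -> int), diagf (fun x => cis (g x)) =
    cis a *: diagf (fun x => cis ((z x)%:~R * (pi *+ 2) / 2 ^+ k.+1)).
Proof.
move=> /CH_power_scalar[c]; rewrite diagfX => gc.
have gx x : cis (g x) ^+ (2 ^ k.+1) = c.
  by have /matrixP/(_ x x) := gc; rewrite diagfE mxE eqxx.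
have [x0 _] := bits_surj (fun _ : 'I_n => ord0).
have /fin_all_exists[z gz] x : exists z : int,
    cis (g x - g x0) = cis (z%:~R * (pi *+ 2) / 2 ^+ k.+1).
  apply: cis_root; rewrite cisD exprMn gx -conj_cis -rmorphXn gx /= -(gx x0).
  by rewrite rmorphXn /= conj_cis -exprMn -cisD subrr cis0 expr1n.
exists (g x0), z; apply/matrixP => x y; rewrite diagfE [RHS]mxE diagfE -gz [RHS]mulrnAr.
by rewrite -cisD addrC subrK.
Qed.

Theorem mainTheorem1 (R : realType) (n : nat) (hn : (1 <= n)%N)
    (U : 'M[R[i]]_(2 ^ n)) (hU : U \is unitarymx) (hsc : semi_clifford U) :
  inCH U <->
  exists (C1 C2 : 'M[R[i]]_(2 ^ n)) (m : nat) (alpha : 'I_m -> int)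
         (k : 'I_m -> nat) (Z : 'I_m -> 'M[R[i]]_(2 ^ n)),
    [/\ clifford C1, clifford C2,
        forall j, (0 < k j)%N,
        forall j, nonid_pauliZ_string (Z j) &
        eq_phase U
          (C1 *m (\prod_(j < m) expi ((alpha j)%:~R * pi / 2 ^+ k j) (Z j))
              *m C2)].
Proof.
split=> [[[//|k] _ HU]|[C1 [C2 [m [alpha [k [Z [cC1 cC2 _ HZ [c c1 ->]]]]]]]]].
  have [_ [C1 [C2 [m [theta [Z [cC1 cC2 _ HZ [c c1 Uc]]]]]]]] := hsc.
  have /fin_all_exists[b Zb] j : exists b, Z j = zstr b.
    exact: (pauliZ_stringP _).1 (HZ j).1.
  have c0 : c != 0 by rewrite -normr_eq0 c1 oner_eq0.
  have DE : \prod_(j < m) expi (theta j) (Z j) = diagf (fun x => cis (angle b theta x)).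
    by rewrite (eq_bigr _ (fun j _ => congr1 (expi (theta j)) (Zb j))) prod_expi.
  rewrite DE in Uc.
  (* Removing Clifford factors needs level at least two, so [U] is first raised by one level. *)
  have HD : CH k.+2 (diagf (fun x => cis (angle b theta x))).
    apply: (CH_cliffordK cC1 cC2).
    have -> : C1 *m diagf (fun x => cis (angle b theta x)) *m C2 = c^-1 *: U.
      by rewrite Uc scalerA mulVf // scale1r.
    by apply: CH_phase; [rewrite normfV c1 invr1 | exact: CH_succ].
  have [a [z gz]] := CH_diagonal_roots HD.
  have [m' [alpha [k' [Z' [k0 Z'n [c' c'1 ZE]]]]]] := @dyadic_diagonal R n k.+2 z isT.
  exists C1, C2, m', alpha, k', Z'; split=> //.
  exists (c * (cis a * c')).
    by rewrite !normrM c1 c'1 norm_cis !mulr1.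
  by rewrite Uc gz ZE scalerA -scalemxAr -scalemxAl scalerA.
have /fin_all_exists[b Zb] j : exists b, Z j = zstr b.
  exact: (pauliZ_stringP _).1 (HZ j).1.
(* The largest exponent gives a common denominator [2 ^+ d]. The diagonal part has level [d.+1],
   raised once more so that Clifford factors are allowed even for [d = 0]. *)
pose d := (\max_j k j)%N.
exists d.+2; first by [].
apply: (CH_phase c1); apply: (CH_cliffordr cC2).
apply: (CH_cliffordl cC1); apply: CH_succ.
rewrite (eq_bigr _ (fun j _ => congr1 (expi _) (Zb j))).
apply: dyadic_CH => j; have kd : (k j <= d)%N := leq_bigmax j.
exists (alpha j * 2 ^+ (d - k j)).
have e2 e : 2 ^+ e != 0 :> R by rewrite expf_neq0 // pnatr_eq0.
by rewrite -{2}(subnK kd) exprD rmorphM rmorphXn /=; field; rewrite !e2.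
Qed.
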